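(* Let $(M^3,g)$ be a 3-dimensional pseudo-Riemannian manifold with Lorentzian metric $g$, and let $\alpha: I\subset\mathbb{R}\to M^3$ be a non-null unit speed Frenet curve with Frenet frame $\{V_1,V_2,V_3\}$, causal characters $\varepsilon_1,\varepsilon_2,\varepsilon_3$ and nowhere zero curvature $\kappa$ and torsion $\tau$. Assume that $\alpha$ is not a helix. Let $f:M^3\to\mathbb{R}$ be a smooth function which is eikonal along $\alpha$ and whose Hessian satisfies $H^f=0$. If $\alpha$ is a non-null $f$-eikonal slant helix in $M^3$, then: (i) the function $$\frac{\kappa^2}{\left|\varepsilon_1\tau^2+\varepsilon_3\kappa^2\right|^{3/2}}\left(\frac{\tau}{\kappa}\right)'$$ is a real constant; (ii) the axis $\nabla f$ of the $f$-eikonal slant helix is given along $\alpha$ by $$\nabla f=\frac{n\tau}{\sqrt{|\varepsilon_1\tau^2+\varepsilon_3\kappa^2|}}V_1+cV_2-\frac{n\kappa}{\sqrt{|\varepsilon_1\tau^2+\varepsilon_3\kappa^2|}}V_3,$$ where $c$ and $n$ are non-zero constants.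
   Context: The metric $g$ is Lorentzian of signature $(-,+,+)$, $M^3$ is time-oriented, and $\nabla$ denotes its Levi-Civita connection. A unit speed non-null curve $\alpha(s)$ satisfies $g(\alpha',\alpha')=\varepsilon_1=\pm1$; it is a Frenet curve if $g(\alpha'',\alpha'')\neq0$, where $\alpha''=\nabla_{\alpha'}\alpha'$. Such a curve has an orthonormal Frenet frame $\{V_1=\alpha',V_2,V_3\}$ along it with $\varepsilon_i=g(V_i,V_i)=\pm1$, $\varepsilon_3=-\varepsilon_1\varepsilon_2$, satisfying $$\nabla_{V_1}V_1=\varepsilon_2\kappa V_2,\quad \nabla_{V_1}V_2=-\varepsilon_1\kappa V_1-\varepsilon_3\tau V_3,\quad \nabla_{V_1}V_3=\varepsilon_2\tau V_2,$$ where $\kappa\ge 0$ is the curvature and $\tau$ the torsion. A prime denotes differentiation with respect to $s$. ''Helix'' means general helix: the ratio $\tau/\kappa$ is constant along $\alpha$. For $f:M^3\to\mathbb{R}$ smooth, $\nabla f$ is the gradient, $g(\nabla f,X)=X(f)$, and the Hessian is $H^f(X,Y)=g(\nabla_X(\nabla f),Y)$. The function $f$ is eikonal along $\alpha$ if $\|\nabla f\|=\sqrt{|g(\nabla f,\nabla f)|}$ is constant along $\alpha$. If $f$ is eikonal along $\alpha$, then $\alpha$ is a non-null $f$-eikonal slant helix if the function $g(\nabla f,V_2)$ is a non-zero constant along $\alpha$; in that case $\nabla f$ is called its axis. *)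

(* Defs.v *)
From HB Require Import structures.
From mathcomp Require Import all_boot all_order all_algebra.
From mathcomp Require Import all_classical all_reals all_analysis.

Set Implicit Arguments.
Unset Strict Implicit.
Unset Printing Implicit Defensive.

Import Order.TTheory GRing.Theory Num.Theory.
Import numFieldNormedType.Exports.

Local Open Scope classical_set_scope.
Local Open Scope ring_scope.

(* C^oo on an open set U of a finite-dimensional space: every iterated
   directional derivative is (Frechet) differentiable at every point of U.    *)
Section Smooth.
Variables (R : realType) (V W : normedModType R).

Fixpoint iter_derive (vs : seq V) (f : V -> W) : V -> W :=
  if vs is v :: vs' then fun x => 'D_v (iter_derive vs' f) x else f.

Definition smooth_on (U : set V) (f : V -> W) : Prop :=
  forall (vs : seq V) (x : V), U x -> differentiable (iter_derive vs f) x.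

End Smooth.

(* A chart is a homeomorphism [cmap] from [cdom] onto an open set of R^3; both
   maps are total functions whose values off the relevant sets are junk.      *)
Record chart (R : realType) (T : topologicalType) := Chart {
  cdom : set T;
  cmap : T -> 'rV[R]_3;
  cinv : 'rV[R]_3 -> T }.

Definition cimg (R : realType) (T : topologicalType) (c : chart R T) :
  set 'rV[R]_3 := cmap c @` cdom c.

Definition is_chart (R : realType) (T : topologicalType) (c : chart R T) :
    Prop :=
  [/\ open (cdom c), open (cimg c),
      (forall p, cdom c p -> cinv c (cmap c p) = p),
      (forall p, cdom c p -> {for p, continuous (cmap c)}) &
      (forall x, cimg c x -> {for x, continuous (cinv c)})].

(* Smooth 3-manifolds without boundary. The atlas need not be maximal.
   [chart_at] singles out one chart around every point, in which tangent
   vectors are written as triples of reals; nothing below depends on it.      *)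
Record manifold3 (R : realType) := Manifold3 {
  mpoint :> topologicalType;
  atlas : set (chart R mpoint);
  chart_at : mpoint -> chart R mpoint;
  manifold_hausdorff : hausdorff_space mpoint;
  manifold_second_countable : @second_countable mpoint;
  atlas_chart : forall c, atlas c -> is_chart c;
  atlas_smooth : forall c d, atlas c -> atlas d ->
    smooth_on (cmap c @` (cdom c `&` cdom d)) (cmap d \o cinv c);
  chart_at_atlas : forall p, atlas (chart_at p);
  chart_at_dom : forall p, cdom (chart_at p) p }.

Section Geometry.
Variables (R : realType) (M : manifold3 R).
Implicit Types (p : M) (c : chart R M).

(* A tangent vector at p is given by its components in the chart [chart_at p];
   its components in any other chart are obtained with the Jacobian of the
   transition map.                                                            *)
Definition tangent (p : M) : lmodType R := 'rV[R]_3.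

Definition to_chart c p (v : tangent p) : 'rV[R]_3 :=
  'd (cmap c \o cinv (chart_at p)) (cmap (chart_at p) p) (v : 'rV[R]_3).

Definition of_chart c p (u : 'rV[R]_3) : tangent p :=
  'd (cmap (chart_at p) \o cinv c) (cmap c p) u.

(* i-th coordinate vector field of the chart c *)
Definition coord_field c (i : 'I_3) p : tangent p :=
  of_chart c p (delta_mx 0 i).

Definition vector_field := forall p, tangent p.

Definition smooth_field (X : vector_field) : Prop :=
  forall c, atlas c ->
    smooth_on (cimg c) (fun x => to_chart c (X (cinv c x))).

Definition smooth_fun (f : M -> R) : Prop :=
  forall c, atlas c -> smooth_on (cimg c) (f \o cinv c : 'rV[R]_3 -> R^o).

(* X(f) *)
Definition dir_deriv p (v : tangent p) (f : M -> R) : R :=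
  'd (f \o cinv (chart_at p) : 'rV[R]_3 -> R^o) (cmap (chart_at p) p)
    (v : 'rV[R]_3).

Definition tensor2 := forall p, tangent p -> tangent p -> R.

Definition metric_coef (g : tensor2) c (i j : 'I_3) (x : 'rV[R]_3) : R :=
  g (cinv c x) (coord_field c i (cinv c x)) (coord_field c j (cinv c x)).

(* The rows of P below are an orthonormal basis of the tangent space at p of
   type (-,+,+).                                                              *)
Record lorentz_metric (g : tensor2) : Prop := LorentzMetric {
  metric_sym : forall p (u v : tangent p), g p u v = g p v u;
  metric_linear : forall p (a : R) (u v w : tangent p),
    g p (a *: u + v) w = a * g p u w + g p v w;
  metric_smooth : forall c i j, atlas c ->
    smooth_on (cimg c) (metric_coef g c i j : 'rV[R]_3 -> R^o);
  metric_signature : forall p, exists P : 'M[R]_3, P \in unitmx /\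
    forall i j : 'I_3, g p (row i P) (row j P) =
      if i == j then (if i == ord0 then -1 else 1) else 0 }.

Definition time_orientation (g : tensor2) (T : vector_field) : Prop :=
  smooth_field T /\ forall p, g p (T p) (T p) < 0.

(* Levi-Civita connection, through its Christoffel symbols
   Gamma^k_ij = 1/2 g^kl (d_i g_jl + d_j g_il - d_l g_ij).                    *)
Definition metric_mx (g : tensor2) c (x : 'rV[R]_3) : 'M[R]_3 :=
  \matrix_(i, j) metric_coef g c i j x.

Definition partial (l : 'I_3) (h : 'rV[R]_3 -> R) (x : 'rV[R]_3) : R :=
  'D_(delta_mx 0 l) (h : 'rV[R]_3 -> R^o) x.

Definition christoffel (g : tensor2) c (k i j : 'I_3) (x : 'rV[R]_3) : R :=
  2^-1 * \sum_(l < 3) invmx (metric_mx g c x) k l *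
    (partial i (metric_coef g c j l) x + partial j (metric_coef g c i l) x
     - partial l (metric_coef g c i j) x).

Definition gamma (g : tensor2) c (x u v : 'rV[R]_3) : 'rV[R]_3 :=
  \row_k \sum_(i < 3) \sum_(j < 3) christoffel g c k i j x * u 0 i * v 0 j.

(* [nabla g v X] is nabla_v X and, below, [nabla_along g alpha V] is
   nabla_{alpha'} V for a vector field V along alpha. Both are tensorial under
   changes of charts, so evaluating them in [chart_at] is no restriction.     *)
Definition nabla (g : tensor2) p (v : tangent p) (X : vector_field) :
    tangent p :=
  let c := chart_at p in
  'd (fun x : 'rV[R]_3 => to_chart c (X (cinv c x))) (cmap c p)
     (v : 'rV[R]_3)
  + gamma g c (cmap c p) v (X p).

Definition gradient (g : tensor2) (f : M -> R) : vector_field := fun p =>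
  xget 0 [set w : tangent p | forall v : tangent p, g p w v = dir_deriv v f].

Definition hessian (g : tensor2) (f : M -> R) p (X Y : tangent p) : R :=
  g p (nabla g X (gradient g f)) Y.

Section Curve.
Variables (I : set R) (alpha : R -> M).

Definition field_along := forall s : R, tangent (alpha s).

Definition smooth_curve : Prop :=
  (forall s, I s -> {for s, continuous alpha}) /\
  forall c, atlas c ->
    smooth_on (I `&` alpha @^-1` cdom c) (cmap c \o alpha : R^o -> 'rV[R]_3).

Definition smooth_along (V : field_along) : Prop :=
  forall c, atlas c ->
    smooth_on (I `&` alpha @^-1` cdom c)
      (fun s : R^o => to_chart c (V s)).

Definition velocity : field_along := fun s =>
  derive1 (cmap (chart_at (alpha s)) \o alpha : R^o -> 'rV[R]_3) s.

Definition nabla_along (g : tensor2) (V : field_along) : field_along :=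
  fun s =>
    let c := chart_at (alpha s) in
    derive1 (fun t : R^o => to_chart c (V t)) s
    + gamma g c (cmap c (alpha s)) (velocity s) (V s).

(* non-null unit speed Frenet curve defined on an open interval *)
Record frenet_curve (g : tensor2) (eps1 : R) : Prop := FrenetCurve {
  curve_open : open I;
  curve_interval : is_interval I;
  curve_nonempty : I !=set0;
  curve_smooth : smooth_curve;
  curve_causal : eps1 = 1 \/ eps1 = -1;
  curve_unit_speed : forall s, I s ->
    g (alpha s) (velocity s) (velocity s) = eps1;
  curve_acceleration : forall s, I s ->
    g (alpha s) (nabla_along g velocity s) (nabla_along g velocity s) != 0 }.

Record frenet_frame (g : tensor2) (eps1 eps2 eps3 : R)
    (V1 V2 V3 : field_along) (kappa tau : R -> R) : Prop := FrenetFrame {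
  frame_smooth : [/\ smooth_along V1, smooth_along V2 & smooth_along V3];
  frame_tangent : forall s, I s -> V1 s = velocity s;
  frame_signs : [/\ eps1 = 1 \/ eps1 = -1, eps2 = 1 \/ eps2 = -1,
    eps3 = 1 \/ eps3 = -1 & eps3 = - (eps1 * eps2)];
  frame_norms : forall s, I s ->
    [/\ g (alpha s) (V1 s) (V1 s) = eps1, g (alpha s) (V2 s) (V2 s) = eps2 &
        g (alpha s) (V3 s) (V3 s) = eps3];
  frame_orthogonal : forall s, I s ->
    [/\ g (alpha s) (V1 s) (V2 s) = 0, g (alpha s) (V1 s) (V3 s) = 0 &
        g (alpha s) (V2 s) (V3 s) = 0];
  frame_curvature_ge0 : forall s, I s -> 0 <= kappa s;
  frame_equations : forall s, I s ->
    [/\ nabla_along g V1 s = (eps2 * kappa s) *: V2 s,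
        nabla_along g V2 s =
          - ((eps1 * kappa s) *: V1 s) - (eps3 * tau s) *: V3 s &
        nabla_along g V3 s = (eps2 * tau s) *: V2 s] }.

Definition eikonal_along (g : tensor2) (f : M -> R) : Prop :=
  exists r : R, forall s, I s ->
    Num.sqrt `| g (alpha s) (gradient g f (alpha s))
                            (gradient g f (alpha s)) | = r.

Definition eikonal_slant_helix (g : tensor2) (f : M -> R) (V2 : field_along) :
    Prop :=
  exists2 c : R, c != 0 &
    forall s, I s -> g (alpha s) (gradient g f (alpha s)) (V2 s) = c.

End Curve.

End Geometry.

Definition helix (R : realType) (I : set R) (kappa tau : R -> R) : Prop :=
  exists k : R, forall s, I s -> tau s / kappa s = k.

(* Main.v *)
Require Import Defs.
From HB Require Import structures.
From mathcomp Require Import all_boot all_order all_algebra.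
From mathcomp Require Import all_classical all_reals all_analysis.
From mathcomp Require Import ring lra.
Import Order.TTheory GRing.Theory Num.Theory.
Import numFieldNormedType.Exports.
Local Open Scope classical_set_scope.
Local Open Scope ring_scope.

(** The axis [grad f] is parallel because the Hessian of [f] vanishes, so the
    derivatives of the products [a_i = g(grad f, V_i)] are given by the Frenet
    equations alone ([is_derive_gradient_along]). Since [a_2 = c] is constant and
    non-zero, they read
      [a_1' = eps2 kappa c],  [a_3' = eps2 tau c],
      [eps1 kappa a_1 + eps3 tau a_3 = 0].
    The last equation makes [K = eps1 a_1^2 + eps3 a_3^2] a first integral
    ([first_integral]).

    If [K = 0], then [a_3 = sg a_1], where [sg] is the sign of the torsion,
    constant by Darboux's theorem; hence [tau = sg kappa], and the curve is a
    helix ([first_integral_neq0]). So [K] is non-zero and [a_3] has no zero. Then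
      [D = eps1 tau^2 + eps3 kappa^2 = kappa^2 K / a_3^2],
      [tau / kappa = - eps1 eps3 a_1 / a_3],
    which exhibits [tau / kappa] as a differentiable function with derivative
    [eps3 c kappa K / a_3^3]. The invariant in the first claim is therefore the
    constant [sg eps3 c K / |K|^(3/2)], with [sg] now the constant sign of [a_3],
    and expanding the axis in the orthonormal frame gives the second one with
    [n = - eps3 sg sqrt |K|] ([slant_system]).

    The geometric input is metric compatibility of the connection along a curve
    ([is_derive_metric_along]). It is proved in one chart from the Christoffel
    symbols, and it needs the coordinate expression of the gradient to be
    differentiable, which holds because the inverse of the Gram matrix of the
    metric is ([differentiable_gradient]). *)

Set Implicit Arguments.
Unset Strict Implicit.
Unset Printing Implicit Defensive.

(** * Differentials and matrix-valued maps *)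

Section Calculus.
Variables (R : realType).

(** The first-order expansion at [x] only sees a neighbourhood of [x], so it
    passes from [f] to [g]. This is what allows formulas valid on a chart
    domain to be differentiated although all maps are total. *)
Lemma near_eq_diff (V W : normedModType R) (f g : V -> W) (x : V) :
  (\forall y \near x, f y = g y) -> differentiable f x ->
  differentiable g x /\ 'd g x = 'd f x :> (V -> W).
Proof.
move=> fg df; have fgx := nbhs_singleton fg.
have gE : g \o shift x = cst (g x) + 'd f x +o_ 0 id.
  apply/eqaddoP => _/posnumP[e].
  have := diff_locally df => /eqaddoP /(_ e%:num (gt0 e)) H.
  have fg0 : \forall y \near (0 : V), f (y + x) = g (y + x).
    by move: fg; rewrite (near_shift 0 x); apply: filterS => y /=; rewrite subr0.
  apply: filterS2 H fg0 => y; rewrite /= !fctE /= => + fgy.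
  by rewrite -fgy fgx.
have dE : 'd g x = 'd f x :> (V -> W) by apply: diff_unique gE; apply: diff_continuous.
split; last exact: dE.
apply/diff_locallyP; rewrite dE; split; last exact: gE.
exact: diff_continuous.
Qed.

Lemma near_eq_differentiable (V W : normedModType R) (f g : V -> W) (x : V) :
  (\forall y \near x, f y = g y) -> differentiable f x -> differentiable g x.
Proof. by move=> fg /(near_eq_diff fg)[]. Qed.

Lemma differentiable_mx (V : normedModType R) m n (A : V -> 'M[R]_(m.+1, n.+1)) x :
  (forall i j, differentiable (fun y => A y i j : R^o) x) -> differentiable A x.
Proof.
move=> dA.
have -> : A = \sum_(i < m.+1) \sum_(j < n.+1)
    (fun y => A y i j *: delta_mx i j : 'M[R]_(m.+1, n.+1)).
  apply/funext => y; rewrite [LHS]matrix_sum_delta fct_sumE.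
  by apply: eq_bigr => i _; rewrite fct_sumE.
apply: differentiable_sum => i; apply: differentiable_sum => j.
exact: differentiableZl.
Qed.

Lemma diff_mxE (V : normedModType R) m n (A : V -> 'M[R]_(m.+1, n.+1)) x v i j :
  differentiable A x ->
  ('d A x v) i j = 'd (fun y => A y i j : R^o) x v.
Proof.
move=> dA; rewrite -!deriveE//; last first.
  apply: (@differentiable_comp _ _ _ _ A (fun B : 'M[R]_(m.+1, n.+1) => B i j : R^o)) => //.
  exact: differentiable_coord.
by rewrite derive_mx ?mxE//; exact: diff_derivable.
Qed.

Lemma differentiable_entry (V : normedModType R) m n (A : V -> 'M[R]_(m.+1, n.+1)) x i j :
  differentiable A x -> differentiable (fun y => A y i j : R^o) x.
Proof.
move=> dA.
apply: (@differentiable_comp _ _ _ _ A (fun B : 'M[R]_(m.+1, n.+1) => B i j : R^o)) => //.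
exact: differentiable_coord.
Qed.

Lemma differentiable_prod_seq (V : normedModType R) (J : Type) (r : seq J) (P : pred J)
    (h : J -> V -> R^o) x :
  (forall i, differentiable (h i) x) ->
  differentiable (fun y => \prod_(i <- r | P i) h i y : R^o) x.
Proof.
move=> dh; elim: r => [|i r IH].
  under eq_fun do rewrite big_nil; exact: differentiable_cst.
under eq_fun do rewrite big_cons; case: (P i) => //.
exact: differentiableM.
Qed.

Lemma differentiable_sum_seq (V : normedModType R) (J : Type) (r : seq J) (P : pred J)
    (h : J -> V -> R^o) x :
  (forall i, differentiable (h i) x) ->
  differentiable (fun y => \sum_(i <- r | P i) h i y : R^o) x.
Proof.
move=> dh; elim: r => [|i r IH].
  under eq_fun do rewrite big_nil; exact: differentiable_cst.
under eq_fun do rewrite big_cons; case: (P i) => //.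
exact: differentiableD.
Qed.

Lemma differentiable_det (V : normedModType R) n (A : V -> 'M[R]_n) x :
  (forall i j, differentiable (fun y => A y i j : R^o) x) ->
  differentiable (fun y => \det (A y) : R^o) x.
Proof.
move=> dA; apply: differentiable_sum_seq => s.
apply: differentiableM; first exact: differentiable_cst.
by apply: differentiable_prod_seq.
Qed.

(** By Cramer's rule the entries of the inverse are polynomials in the entries
    of the matrix divided by its determinant. *)
Lemma differentiable_invmx (V : normedModType R) n (A : V -> 'M[R]_n) x i j :
  (\forall y \near x, A y \in unitmx) ->
  (forall i j, differentiable (fun y => A y i j : R^o) x) ->
  differentiable (fun y => invmx (A y) i j : R^o) x.
Proof.
move=> uA dA.
apply: (@near_eq_differentiable _ _ (fun y => (\det (A y))^-1 * \adj (A y) i j : R^o)).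
  by near=> y; rewrite /invmx (near uA y) // !mxE.
apply: differentiableM.
  apply: differentiableV; first exact: differentiable_det.
  by have := nbhs_singleton uA; rewrite unitmxE unitfE.
under eq_fun do rewrite mxE; rewrite /cofactor.
apply: differentiableM; first exact: differentiable_cst.
apply: differentiable_det => k l; under eq_fun do rewrite !mxE.
exact: dA.
Unshelve. all: by end_near. Qed.

End Calculus.

(** * Change of charts *)

Section Charts.
Variables (R : realType) (M : manifold3 R).
Implicit Types (p : M) (c d : chart R M).

Lemma cinvK c p : atlas c -> cdom c p -> cinv c (cmap c p) = p.
Proof. by move=> /atlas_chart[_ _ + _ _]; apply. Qed.

Lemma cimg_map c p : cdom c p -> cimg c (cmap c p).
Proof. by move=> cp; exists p. Qed.

Lemma near_cimg c p : atlas c -> cdom c p ->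
  \forall x \near cmap c p, cimg c x.
Proof.
by move=> /atlas_chart[_ oc _ _ _] cp; apply: open_nbhs_nbhs; split=> //; exists p.
Qed.

Lemma cmapK c x : atlas c -> cimg c x -> cmap c (cinv c x) = x.
Proof. by move=> ac [p cp <-]; rewrite cinvK. Qed.

Lemma cimg_inv c x : atlas c -> cimg c x -> cdom c (cinv c x).
Proof. by move=> ac [p cp <-]; rewrite cinvK. Qed.

Lemma near_cdom c d p : atlas c -> cdom c p -> atlas d -> cdom d p ->
  \forall x \near cmap c p, cdom d (cinv c x).
Proof.
move=> ac cp ad dp; have [_ _ _ _ cc] := atlas_chart ac.
apply: cc; first exact: cimg_map.
rewrite /= cinvK//; have [od _ _ _ _] := atlas_chart ad.
exact: open_nbhs_nbhs.
Qed.

Lemma differentiable_transition c d p :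
  atlas c -> cdom c p -> atlas d -> cdom d p ->
  differentiable (cmap d \o cinv c) (cmap c p).
Proof.
by move=> ac cp ad dp; apply: (atlas_smooth ac ad [::]); exists p.
Qed.

(** The chain rule along [h \o cinv c = (h \o cinv d) \o (cmap d \o cinv c)],
    which holds near [cmap c p]. It is the source of every coordinate change
    below: with [h] a coordinate map it inverts Jacobians, with [h] a real
    function it makes [dir_deriv] independent of the chart. *)
Lemma diff_change_chart (W : normedModType R) (h : M -> W) c d p u :
  atlas c -> cdom c p -> atlas d -> cdom d p ->
  differentiable (h \o cinv d) (cmap d p) ->
  'd (h \o cinv c) (cmap c p) u =
  'd (h \o cinv d) (cmap d p) ('d (cmap d \o cinv c) (cmap c p) u).
Proof.
move=> ac cp ad dp dh; have dt := differentiable_transition ac cp ad dp.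
have E : (cmap d \o cinv c) (cmap c p) = cmap d p by rewrite /= cinvK.
move: dh; rewrite -E => dh.
have near_h : \forall x \near cmap c p,
    ((h \o cinv d) \o (cmap d \o cinv c)) x = (h \o cinv c) x.
  by near=> x; rewrite /= cinvK//; near: x; exact: near_cdom.
have dth := differentiable_comp dt dh.
have [_ dE] := near_eq_diff near_h dth.
apply: etrans (congr1 (@^~ u) dE) _.
exact: (congr1 (@^~ u) (diff_comp dt dh)).
Unshelve. all: by end_near. Qed.

Lemma diff_cmapK c p (u : 'rV[R]_3) : atlas c -> cdom c p ->
  'd (cmap c \o cinv c) (cmap c p) u = u.
Proof.
move=> ac cp.
have near_id : \forall x \near cmap c p, id x = (cmap c \o cinv c) x.
  by near=> x; rewrite /= cmapK//; near: x; exact: near_cimg.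
have did : is_diff (cmap c p) (@id 'rV[R]_3) id by exact: is_diff_id.
have [_ dE] := near_eq_diff near_id (ex_diff (is_diff_def := did)).
apply: etrans (congr1 (@^~ u) dE) _.
exact: (congr1 (@^~ u) (diff_val (is_diff_def := did))).
Unshelve. all: by end_near. Qed.

Lemma of_chartK c p (u : 'rV[R]_3) : atlas c -> cdom c p ->
  to_chart c (of_chart c p u) = u.
Proof.
move=> ac cp; have aq := chart_at_atlas p; have qp := chart_at_dom p.
apply: etrans (diff_cmapK u ac cp); apply/esym.
exact: (diff_change_chart u ac cp aq qp (differentiable_transition aq qp ac cp)).
Qed.

Lemma to_chartK c p (v : tangent p) : atlas c -> cdom c p ->
  of_chart c p (to_chart c v) = v.
Proof.
move=> ac cp; have aq := chart_at_atlas p; have qp := chart_at_dom p.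
apply: etrans (diff_cmapK _ aq qp); apply/esym.
exact: (diff_change_chart _ aq qp ac cp (differentiable_transition ac cp aq qp)).
Qed.

Lemma to_chart_at p (v : tangent p) : to_chart (chart_at p) v = v.
Proof. by rewrite /to_chart diff_cmapK//; [exact: chart_at_atlas|exact: chart_at_dom]. Qed.

Lemma of_chart_sum c p (u : 'rV[R]_3) :
  of_chart c p u = \sum_(i < 3) u 0 i *: coord_field c i p.
Proof.
rewrite {1}(row_sum_delta u) /of_chart linear_sum.
by apply: eq_bigr => i _; rewrite linearZ.
Qed.

Lemma dir_deriv_chart (f : M -> R) c p (v : tangent p) : smooth_fun f ->
  atlas c -> cdom c p ->
  dir_deriv v f = \sum_(i < 3) (to_chart c v) 0 i * partial i (f \o cinv c) (cmap c p).
Proof.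
move=> sf ac cp; have aq := chart_at_atlas p; have qp := chart_at_dom p.
have dfc : differentiable (f \o cinv c : 'rV[R]_3 -> R^o) (cmap c p).
  by apply: (sf c ac [::]); exact: cimg_map.
rewrite /dir_deriv (diff_change_chart (W := R^o) (h := f) _ aq qp ac cp)//.
rewrite [RHS](_ : _ = 'd (f \o cinv c : 'rV[R]_3 -> R^o) (cmap c p) (to_chart c v))//.
rewrite [in RHS](row_sum_delta (to_chart c v)) linear_sum.
by apply: eq_bigr => i _; rewrite linearZ /partial deriveE.
Qed.

End Charts.

(** * The metric in coordinates *)

Section Metric.
Variables (R : realType) (M : manifold3 R) (g : tensor2 M).
Hypothesis lg : lorentz_metric g.
Implicit Types (p : M) (c d : chart R M).

Lemma metricC p (u v : tangent p) : g u v = g v u.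
Proof. exact: (Defs.metric_sym lg). Qed.

Lemma metricDl p (u v w : tangent p) : g (u + v) w = g u w + g v w.
Proof. by have := metric_linear lg 1 u v w; rewrite scale1r mul1r. Qed.

Lemma metric0l p (w : tangent p) : g 0 w = 0.
Proof. by have := metricDl 0 0 w; rewrite addr0; lra. Qed.

Lemma metricZl p a (u w : tangent p) : g (a *: u) w = a * g u w.
Proof. by have := metric_linear lg a u 0 w; rewrite addr0 metric0l addr0. Qed.

Lemma metric_suml p n (h : 'I_n -> tangent p) (w : tangent p) :
  g (\sum_(i < n) h i) w = \sum_(i < n) g (h i) w.
Proof.
by elim/big_ind2 : _ => //; [exact: metric0l|move=> x1 x2 y1 y2 <- <-; exact: metricDl].
Qed.

Lemma metric_sumr p n (h : 'I_n -> tangent p) (w : tangent p) :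
  g w (\sum_(i < n) h i) = \sum_(i < n) g w (h i).
Proof. by rewrite metricC metric_suml; apply: eq_bigr => i _; rewrite metricC. Qed.

Lemma metricZr p a (u w : tangent p) : g w (a *: u) = a * g w u.
Proof. by rewrite metricC metricZl metricC. Qed.

Lemma metric_chart c p (u v : tangent p) : atlas c -> cdom c p ->
  g u v = \sum_(i < 3) \sum_(j < 3)
    to_chart c u 0 i * metric_coef g c i j (cmap c p) * to_chart c v 0 j.
Proof.
move=> ac cp.
rewrite -{1}(to_chartK u ac cp) -{1}(to_chartK v ac cp) !of_chart_sum metric_suml.
apply: eq_bigr => i _; rewrite metric_sumr; apply: eq_bigr => j _.
by rewrite metricZl metricZr /metric_coef cinvK// -mulrA (mulrC (_ 0 j)).
Qed.

(** In an orthonormal basis of the tangent space each coefficient of [u] is,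
    up to sign, the product of [u] with a basis vector. *)
Lemma metric_nondegenerate p (u : tangent p) : (forall v, g u v = 0) -> u = 0.
Proof.
move=> u0; have [P [uP gP]] := metric_signature lg p.
pose b : 'rV[R]_3 := (u : 'rV[R]_3) *m invmx P.
have uE : u = \sum_(i < 3) b 0 i *: (row i P : tangent p).
  by rewrite -[LHS](mulmxKV uP) mulmx_sum_row.
suff b0 : b = 0 by rewrite uE b0; apply: big1 => i _; rewrite mxE scale0r.
apply/rowP => j; rewrite [RHS]mxE; have := u0 (row j P).
rewrite uE metric_suml (bigD1 j)//= big1 ?addr0; last first.
  by move=> i ij; rewrite metricZl gP (negPf ij) mulr0.
rewrite metricZl gP eqxx => /eqP; rewrite mulf_eq0 => /orP[/eqP//|].
by case: ifP => _; rewrite ?oppr_eq0 oner_eq0.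
Qed.

Lemma metric_inj p (u w : tangent p) : (forall v, g u v = g w v) -> u = w.
Proof.
move=> uw; apply/eqP; rewrite -subr_eq0; apply/eqP/metric_nondegenerate => v.
by rewrite metricDl -scaleN1r metricZl uw mulN1r subrr.
Qed.

Lemma metric_mx_sym c x : (metric_mx g c x)^T = metric_mx g c x.
Proof. by apply/matrixP => i j; rewrite !mxE /metric_coef metricC. Qed.

(** A vector in the row kernel of the Gram matrix is the coordinate expression
    of a tangent vector orthogonal to everything. *)
Lemma metric_mx_unit c x : atlas c -> cimg c x -> metric_mx g c x \in unitmx.
Proof.
move=> ac [p cp <-]; rewrite -row_free_unit; apply: inj_row_free => u uG.
have : of_chart c p u = 0.
  apply: metric_nondegenerate => v; rewrite (metric_chart _ _ ac cp) of_chartK//.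
  rewrite exchange_big/=; apply: big1 => j _; rewrite -mulr_suml.
  have /matrixP/(_ 0 j) := uG; rewrite !mxE.
  by under eq_bigr do rewrite mxE; move=> ->; rewrite mul0r.
move=> u0; rewrite -(of_chartK u ac cp) u0.
by rewrite /to_chart linear0.
Qed.

Lemma differentiable_metric_coef c i j x : atlas c -> cimg c x ->
  differentiable (metric_coef g c i j : 'rV[R]_3 -> R^o) x.
Proof. by move=> ac cx; exact: (metric_smooth lg i j ac [::]). Qed.

End Metric.

(** * The gradient in coordinates *)

Section Gradient.
Variables (R : realType) (M : manifold3 R) (g : tensor2 M) (f : M -> R).
Hypothesis lg : lorentz_metric g.
Hypothesis sf : smooth_fun f.

(** The classical formula: the partial derivatives of [f] with the index raised
    by the inverse Gram matrix. *)
Definition coord_gradient c x : 'rV[R]_3 :=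
  (\row_j partial j (f \o cinv c) x) *m invmx (metric_mx g c x).

Lemma of_coord_gradient c p (v : tangent p) : atlas c -> cdom c p ->
  g (of_chart c p (coord_gradient c (cmap c p))) v = dir_deriv v f.
Proof.
move=> ac cp; rewrite (metric_chart lg _ _ ac cp) of_chartK//.
rewrite (dir_deriv_chart _ sf ac cp) exchange_big/=; apply: eq_bigr => j _.
rewrite -mulr_suml mulrC; congr (_ * _).
have /matrixP/(_ 0 j) : coord_gradient c (cmap c p) *m metric_mx g c (cmap c p) =
   \row_j partial j (f \o cinv c) (cmap c p).
  by rewrite mulmxKV// metric_mx_unit//; exact: cimg_map.
rewrite [RHS]mxE => <-; rewrite [RHS]mxE; apply: eq_bigr => i _.
by rewrite [metric_mx _ _ _ _ _]mxE.
Qed.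

(** [gradient] is chosen among the vectors representing the differential of
    [f]; [of_coord_gradient] shows that there is one to choose. *)
Lemma gradientE p (v : tangent p) : g (gradient g f p) v = dir_deriv v f.
Proof.
move: v; rewrite /gradient.
case: xgetP => [w _ //|/= nw]; have aq := chart_at_atlas p; have qp := chart_at_dom p.
by have := nw _ (fun v => of_coord_gradient v aq qp).
Qed.

Lemma to_chart_gradient c p : atlas c -> cdom c p ->
  to_chart c (gradient g f p) = coord_gradient c (cmap c p).
Proof.
move=> ac cp; rewrite -[RHS](of_chartK _ ac cp); congr to_chart.
by apply: (metric_inj lg) => v; rewrite gradientE of_coord_gradient.
Qed.

(** The covariant derivative of the gradient is computed by a differential,
    which is meaningful, and obeys the chain rule, because of this lemma. *)
Lemma differentiable_gradient c x : atlas c -> cimg c x ->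
  differentiable (fun y : 'rV[R]_3 => to_chart c (gradient g f (cinv c y))) x.
Proof.
move=> ac cx; have cxn : \forall y \near x, cimg c y.
  by case: cx => p cp <-; exact: near_cimg.
apply: (@near_eq_differentiable _ _ _ (coord_gradient c)).
  near=> y; have cy : cimg c y by near: y.
  by rewrite (to_chart_gradient ac (cimg_inv ac cy)) cmapK.
apply: differentiable_mx => i j.
under eq_fun do rewrite mxE.
apply: differentiable_sum_seq => k; apply: differentiableM.
  under eq_fun do rewrite mxE.
  exact: (sf ac [:: delta_mx 0 k]).
apply: differentiable_invmx.
  by near=> y; apply: metric_mx_unit => //; near: y.
move=> a b; under eq_fun do rewrite mxE.
exact: differentiable_metric_coef.
Unshelve. all: by end_near. Qed.

End Gradient.

(** * Compatibility of the connection with the metric *)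

Section LeviCivita.
Variables (R : realType) (M : manifold3 R) (g : tensor2 M).
Hypothesis lg : lorentz_metric g.
Implicit Types (c : chart R M) (x u a b : 'rV[R]_3).

Definition coord_metric c x a b := \sum_(i < 3) \sum_(j < 3) a 0 i * metric_coef g c i j x * b 0 j.

Lemma coord_metricC c x a b : coord_metric c x a b = coord_metric c x b a.
Proof.
rewrite /coord_metric exchange_big/=; apply: eq_bigr => i _; apply: eq_bigr => j _.
by rewrite /metric_coef (metricC lg); ring.
Qed.

(** Multiplying by the Gram matrix cancels the inverse Gram matrix in the
    Christoffel symbols; what is left is their version with lowered index. *)
Lemma coord_metric_gamma c x u a b : atlas c -> cimg c x ->
  coord_metric c x (gamma g c x u a) b =
  2^-1 * \sum_(k < 3) \sum_(l < 3) \sum_(j < 3)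
    (partial k (metric_coef g c l j) x + partial l (metric_coef g c k j) x
     - partial j (metric_coef g c k l) x) * u 0 k * a 0 l * b 0 j.
Proof.
move=> ac cx.
pose S k l j := partial k (metric_coef g c l j) x + partial l (metric_coef g c k j) x
     - partial j (metric_coef g c k l) x.
have low k l j : \sum_(i < 3) christoffel g c i k l x * metric_coef g c i j x
   = 2^-1 * S k l j.
  have G1 : invmx (metric_mx g c x) *m metric_mx g c x = 1%:M.
    by rewrite mulVmx// metric_mx_unit.
  have Vs m i : invmx (metric_mx g c x) i m = invmx (metric_mx g c x) m i.
    by rewrite -[in RHS](metric_mx_sym lg) -trmx_inv mxE.
  rewrite /christoffel -/(S k l _).
  under eq_bigr do rewrite -mulrA mulr_suml.
  rewrite -mulr_sumr exchange_big/=; congr (_ * _).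
  rewrite (bigD1 j)//= [X in _ + X]big1 ?addr0 => [|m mj].
    under eq_bigr => i _ do rewrite mulrAC Vs.
    rewrite -mulr_suml.
    have /matrixP/(_ j j) := G1; rewrite !mxE eqxx/=.
    under eq_bigr do rewrite [metric_mx _ _ _ _ _]mxE.
    by move=> ->; rewrite mul1r.
  under eq_bigr => i _ do rewrite mulrAC Vs.
  rewrite -mulr_suml.
  have /matrixP/(_ m j) := G1; rewrite !mxE (negPf mj)/=.
  under eq_bigr do rewrite [metric_mx _ _ _ _ _]mxE.
  by move=> ->; rewrite mul0r.
rewrite /coord_metric exchange_big/=.
transitivity (\sum_(j < 3) \sum_(k < 3) \sum_(l < 3) 2^-1 * (S k l j * u 0 k * a 0 l * b 0 j)).
  apply: eq_bigr => j _; rewrite -mulr_suml.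
  under eq_bigr do rewrite mxE mulr_suml.
  rewrite exchange_big/= mulr_suml; apply: eq_bigr => k _.
  under eq_bigr do rewrite mulr_suml.
  rewrite exchange_big/= mulr_suml; apply: eq_bigr => l _.
  rewrite !mulrA -low !mulr_suml; apply: eq_bigr => i _; ring.
rewrite mulr_sumr exchange_big/=; apply: eq_bigr => k _.
rewrite mulr_sumr exchange_big/=; apply: eq_bigr => l _.
by rewrite mulr_sumr.
Qed.

(** Metric compatibility at a point: when the two lowered Christoffel
    expressions are added, the partial derivatives that differentiate along
    [a] or [b] cancel by symmetry, and the derivative of the Gram matrix along
    [u] remains. *)
Lemma gamma_metric c x u a b : atlas c -> cimg c x ->
  coord_metric c x (gamma g c x u a) b + coord_metric c x a (gamma g c x u b) =
  \sum_(l < 3) \sum_(j < 3)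
    a 0 l * (\sum_(k < 3) u 0 k * partial k (metric_coef g c l j) x) * b 0 j.
Proof.
move=> ac cx; rewrite [X in _ + X]coord_metricC !coord_metric_gamma// -mulrDr -big_split/=.
have sw k : \sum_(l < 3) \sum_(j < 3)
    (partial k (metric_coef g c l j) x + partial l (metric_coef g c k j) x
     - partial j (metric_coef g c k l) x) * u 0 k * b 0 l * a 0 j =
   \sum_(l < 3) \sum_(j < 3)
    (partial k (metric_coef g c l j) x + partial j (metric_coef g c k l) x
     - partial l (metric_coef g c k j) x) * u 0 k * a 0 l * b 0 j.
  rewrite exchange_big/=; apply: eq_bigr => l _; apply: eq_bigr => j _.
  (* Only the symmetry of the Gram matrix is left after renaming indices. *)
  have -> : metric_coef g c j l = metric_coef g c l j.
    by apply/funext => y; rewrite /metric_coef (metricC lg).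
  ring.
under eq_bigr do rewrite sw -big_split/=.
under eq_bigr do under eq_bigr do rewrite -big_split/=.
under [RHS]eq_bigr do under eq_bigr do rewrite mulr_sumr mulr_suml.
rewrite mulr_sumr.
under [RHS]eq_bigr do rewrite exchange_big/=.
rewrite [RHS]exchange_big/=; apply: eq_bigr => k _.
rewrite mulr_sumr; apply: eq_bigr => l _.
rewrite mulr_sumr; apply: eq_bigr => j _.
by field.
Qed.

(** Metric compatibility along a curve. In the chart at [alpha s] the function
    is a sum of products of coordinates; the product rule yields the derivatives
    of the two fields and of the Gram matrix, and [gamma_metric] distributes the
    latter to turn ordinary derivatives into covariant ones. *)
Lemma is_derive_metric_along (I : set R) (alpha : R -> M) (X : vector_field M)
    (V : field_along alpha) (s : R) :
  smooth_curve I alpha -> smooth_along I V -> I s ->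
  (let c := chart_at (alpha s) in
   differentiable (fun x : 'rV[R]_3 => to_chart c (X (cinv c x))) (cmap c (alpha s))) ->
  is_derive s 1 (fun t : R => g (X (alpha t)) (V t))
    (g (nabla g (velocity alpha s) X) (V s) + g (X (alpha s)) (nabla_along g V s)).
Proof.
move=> [ca sa] sV Is; set c := chart_at (alpha s) => /= dX.
have ac : atlas c by exact: chart_at_atlas.
have cs : cdom c (alpha s) by exact: chart_at_dom.
have cx : cimg c (cmap c (alpha s)) by exact: cimg_map.
set x0 := cmap c (alpha s).
pose x : R^o -> 'rV[R]_3 := cmap c \o alpha.
pose v : R^o -> 'rV[R]_3 := fun t => to_chart c (V t).
pose Xc : 'rV[R]_3 -> 'rV[R]_3 := fun y => to_chart c (X (cinv c y)).
have dx : differentiable x s by apply: (sa c ac [::]).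
have dv : differentiable v s by apply: (sV c ac [::]).
have ns : \forall t \near (s : R^o), cdom c (alpha t).
  apply: (ca s Is); have [oc _ _ _ _] := atlas_chart ac.
  exact: open_nbhs_nbhs.
apply: (near_eq_is_derive (f := fun t : R => coord_metric c (x t) (Xc (x t)) (v t))).
  near=> t; rewrite /coord_metric /Xc /x /= cinvK//; last by near: t.
  by rewrite -metric_chart//; near: t.
have xv : 'd x s 1 = velocity alpha s by rewrite /velocity derive1E deriveE.
have dxi (h : 'rV[R]_3 -> R^o) : differentiable h x0 ->
    is_derive s 1 (h \o x) ('d h x0 (velocity alpha s)).
  move=> dh; have dhx : differentiable (h \o x) s by exact: differentiable_comp.
  apply: DeriveDef; first exact: diff_derivable.
  by rewrite deriveE// diff_comp//= xv.
have dvi j : is_derive s 1 (fun t => v t 0 j : R^o)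
    (derive1 (fun t : R^o => to_chart c (V t)) s 0 j).
  apply: DeriveDef; first by apply: diff_derivable; exact: differentiable_entry.
  by rewrite derive1E derive_mx ?mxE//; exact: diff_derivable.
have dXi i : is_derive s 1 ((fun y => Xc y 0 i : R^o) \o x) ('d Xc x0 (velocity alpha s) 0 i).
  rewrite diff_mxE//; apply: dxi; exact: differentiable_entry.
have dgi i j := dxi _ (differentiable_metric_coef lg i j ac cx).
have D : is_derive s 1 (fun t : R => coord_metric c (x t) (Xc (x t)) (v t))
  (\sum_(i < 3) \sum_(j < 3)
    (('d Xc x0 (velocity alpha s) 0 i * metric_coef g c i j x0 +
     Xc x0 0 i * 'd (metric_coef g c i j : _ -> R^o) x0 (velocity alpha s)) * v s 0 j +
     Xc x0 0 i * metric_coef g c i j x0 * derive1 (fun t : R^o => to_chart c (V t)) s 0 j)).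
  rewrite /coord_metric (_ : (fun t => _) = \sum_(i < 3) \sum_(j < 3)
     (((fun y => Xc y 0 i : R^o) \o x) * (metric_coef g c i j \o x)
      * (fun t => v t 0 j)))%R; last first.
    apply/funext => t; rewrite fct_sumE; apply: eq_bigr => i _; rewrite fct_sumE.
    by apply: eq_bigr => j _.
  apply: is_derive_sum => i; apply: is_derive_sum => j.
  apply: is_derive_eq.
  rewrite /= /GRing.scale /= -[x s]/x0.
  rewrite -[((_ \o x) * _) s]/(Xc x0 0 i * metric_coef g c i j x0); ring.
refine (is_derive_eq D _).
rewrite !(metric_chart lg _ _ ac cs) !to_chart_at -/x0.
rewrite -[LHS]/(_ : R).
have Xs : Xc x0 = X (alpha s) by rewrite /Xc /x0 cinvK// to_chart_at.
have vs : v s = V s by rewrite /v to_chart_at.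
rewrite Xs vs; set u := velocity alpha s.
have dG i j : 'd (metric_coef g c i j : _ -> R^o) x0 u =
    \sum_(k < 3) u 0 k * partial k (metric_coef g c i j) x0.
  rewrite [in LHS](row_sum_delta u) linear_sum; apply: eq_bigr => k _.
  by rewrite linearZ /partial deriveE//; exact: differentiable_metric_coef.
have -> : nabla g u X = 'd Xc x0 u + gamma g c x0 u (X (alpha s)) by [].
have -> : nabla_along g V s = derive1 (fun t : R^o => to_chart c (V t)) s
  + gamma g c x0 u (V s) by [].
transitivity (
  (\sum_(i < 3) \sum_(j < 3) 'd Xc x0 u 0 i * metric_coef g c i j x0 * V s 0 j +
   coord_metric c x0 (gamma g c x0 u (X (alpha s))) (V s)) +
  (\sum_(i < 3) \sum_(j < 3) (X (alpha s) : 'rV[R]_3) 0 i * metric_coef g c i j x0 *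
      derive1 (fun t : R^o => to_chart c (V t)) s 0 j +
   coord_metric c x0 (X (alpha s)) (gamma g c x0 u (V s)))).
  rewrite addrACA gamma_metric// -!big_split/=; apply: eq_bigr => i _.
  rewrite -!big_split/=; apply: eq_bigr => j _; rewrite dG; ring.
by rewrite /coord_metric; congr (_ + _); rewrite -big_split/=; apply: eq_bigr => i _;
  rewrite -big_split/=; apply: eq_bigr => j _;
  rewrite [((_ : 'rV[R]_3) + _) 0 _]mxE; ring.
Unshelve. all: by end_near. Qed.

End LeviCivita.

(** * Differentiable functions on an interval *)

Section RealLine.
Variables (R : realType) (I : set R).
Hypothesis iI : is_interval I.

Lemma within_derivable (f f' : R -> R) x y : I x -> I y ->
  (forall s, I s -> is_derive s 1 f (f' s)) -> {within `[x, y], continuous f}.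
Proof.
move=> Ix Iy df; apply: derivable_within_continuous => z.
rewrite in_itv/= => zxy; have := df _ (iI Ix Iy zxy).
by case.
Qed.

Lemma eq_of_derive0 (f : R -> R) x y : I x -> I y ->
  (forall s, I s -> is_derive s 1 f 0) -> f x = f y.
Proof.
move=> Ix Iy df.
wlog xy : x y Ix Iy / x <= y by move=> H; case: (leP x y) => [/H|/ltW/H ->]; first exact.
have d z : z \in `]x, y[%R -> is_derive z 1 f ((fun=> 0) z).
  rewrite in_itv/= => /andP[xz zy]; apply: df; apply: (iI Ix Iy).
  by rewrite !ltW.
have [? _] := MVT_segment xy d (within_derivable Ix Iy df).
by rewrite mul0r => /eqP; rewrite subr_eq0 => /eqP.
Qed.

Lemma sign_of_nonzero (f f' : R -> R) : I !=set0 ->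
  (forall s, I s -> is_derive s 1 f (f' s)) -> (forall s, I s -> f s != 0) ->
  exists2 sg : R, sg ^+ 2 = 1 & forall s, I s -> 0 < sg * f s.
Proof.
move=> [x Ix] df f0; exists (Num.sg (f x)); first by rewrite sqr_sg f0.
move=> y Iy; rewrite ltNge; apply/negP => fy.
have fxy : Num.min (f x) (f y) <= 0 <= Num.max (f x) (f y).
  rewrite ge_min le_max; have := f0 _ Ix; move: fy.
  case: (ltgtP (f x) 0) => [fx|fx|//].
    by rewrite ltr0_sg// mulN1r oppr_le0 => -> _; rewrite orbT.
  by rewrite gtr0_sg// mul1r => -> _; rewrite orbT.
have [c cxy fc] : exists2 c, I c & f c = 0.
  case: (leP x y) => [xy|/ltW yx].
    have [c + fc] := IVT xy (within_derivable Ix Iy df) fxy.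
    by rewrite in_itv/= => /(iI Ix Iy) Ic; exists c.
  rewrite minC maxC in fxy.
  have [c + fc] := IVT yx (within_derivable Iy Ix df) fxy.
  by rewrite in_itv/= => /(iI Iy Ix) Ic; exists c.
by have := f0 _ cxy; rewrite fc eqxx.
Qed.

(** A form of Darboux's theorem: by Rolle's theorem [f] is injective, hence
    strictly monotone. It serves for derivatives containing the torsion, whose
    continuity is not among the assumptions. *)
Lemma darboux_sign (f f' : R -> R) : open I ->
  (forall s, I s -> is_derive s 1 f (f' s)) -> (forall s, I s -> f' s != 0) ->
  exists2 sg : R, sg ^+ 2 = 1 & forall s, I s -> 0 < sg * f' s.
Proof.
move=> oI df f0.
have IE : I = [set` Rhull I] by apply/is_intervalP.
have inI x : (x \in Rhull I) = (x \in I).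
  by apply/idP/idP => [xI|/set_mem]; [apply/mem_set; rewrite IE|rewrite {1}IE].
have dfI : {in I° : set R, forall x, derivable f x 1}.
  by move=> x; rewrite inE => /interior_subset Ix; case: (df x Ix).
have f'E x : I x -> derive1 f x = f' x.
  by move=> Ix; rewrite derive1E; case: (df x Ix).
have finj : {in Rhull I &, injective f}.
  suff lt x y : I x -> I y -> x < y -> f x <> f y.
    move=> x y; rewrite !inI !inE => Ix Iy fxy.
    by case: (ltgtP x y) => // xy; [case: (lt _ _ Ix Iy xy)|case: (lt _ _ Iy Ix xy)].
  move=> Ix Iy xy fxy.
  have Iz z : z \in `]x, y[%R -> I z.
    by rewrite in_itv/= => /andP[xz zy]; apply: (iI Ix Iy); rewrite !ltW.
  have dz z : z \in `]x, y[%R -> derivable f z 1.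
    by move=> /Iz Iz'; case: (df z Iz').
  have [c /Iz Ic dc] := Rolle xy dz (within_derivable Ix Iy df) fxy.
  by have := f0 _ Ic; have [_ <-] := df c Ic; have [_ ->] := dc; rewrite eqxx.
have fcont : {within [set` Rhull I], continuous f}.
  apply: derivable_within_continuous => x; rewrite inI inE => Ix.
  by case: (df x Ix).
have Io x : I x -> I° x by move=> Ix; apply: open_nbhs_nbhs.
case: (itv_continuous_inj_mono fcont finj) => fm.
  exists 1; rewrite ?expr1n// => s Is; rewrite mul1r lt_neqAle eq_sym f0//= -f'E//.
  apply: (@incr_derive1_ge0 R f I) => //; last exact: Io.
  by move=> x y Dx Dy; apply: fm; rewrite inI.
exists (-1); rewrite ?sqrrN ?expr1n// => s Is.
rewrite mulN1r oppr_gt0 lt_neqAle f0//= -f'E//.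
apply: (@decr_derive1_le0 R f I) => //; last exact: Io.
by move=> x y Dx Dy; apply: fm; rewrite inI.
Qed.

End RealLine.

(** * The differential system of a slant helix *)

Lemma sqr1_neq0 (R : realType) (x : R) : x ^+ 2 = 1 -> x != 0.
Proof. by apply: contra_eq_neq => ->; rewrite expr0n eq_sym oner_eq0. Qed.

Lemma sqr1_pm1 (R : realType) (x : R) : x ^+ 2 = 1 -> x = 1 \/ x = -1.
Proof. by move=> /eqP; rewrite sqrf_eq1 => /orP[/eqP|/eqP]; [left|right]. Qed.

(** [a1] and [a3] stand for the products of the axis with the tangent and the
    binormal vectors, [k] and [t] for curvature and torsion. The product [c] of
    the axis with the normal vector being constant, the Frenet equations reduce
    to the hypotheses of this section. *)
Section SlantSystem.
Variables (R : realType) (I : set R) (e1 e2 e3 c : R) (k t a1 a3 : R -> R).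
Hypotheses (iI : is_interval I) (oI : open I) (nI : I !=set0).
Hypotheses (e1E : e1 ^+ 2 = 1) (e2E : e2 ^+ 2 = 1) (e3E : e3 = - (e1 * e2)).
Hypotheses (c0 : c != 0) (k0 : forall s, I s -> 0 < k s) (t0 : forall s, I s -> t s != 0).
Hypothesis da1 : forall s, I s -> is_derive s 1 a1 (e2 * k s * c).
Hypothesis da3 : forall s, I s -> is_derive s 1 a3 (e2 * t s * c).
Hypothesis ortho : forall s, I s -> e1 * k s * a1 s + e3 * t s * a3 s = 0.
Hypothesis nhelix : ~ helix I k t.

Let e3S : e3 ^+ 2 = 1.
Proof. by rewrite e3E sqrrN exprMn e1E e2E mulr1. Qed.

(** The derivative is [2 * e2 * c] times the left-hand side of [ortho]. *)
Lemma first_integral : exists K, forall s, I s -> e1 * a1 s ^+ 2 + e3 * a3 s ^+ 2 = K.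
Proof.
have [x Ix] := nI; exists (e1 * a1 x ^+ 2 + e3 * a3 x ^+ 2) => s Is.
apply: (eq_of_derive0 iI Is Ix (f := fun s => e1 * a1 s ^+ 2 + e3 * a3 s ^+ 2)) => y Iy.
have d1 := da1 Iy; have d3 := da3 Iy.
rewrite (_ : (fun s => _) = e1 *: (a1 * a1) + e3 *: (a3 * a3)); last first.
  by apply/funext => z; rewrite /= !fctE/= !expr2.
refine (is_derive_eq (is_deriveD (is_deriveZ e1 (is_deriveM d1 d1))
  (is_deriveZ e3 (is_deriveM d3 d3))) _).
rewrite /GRing.scale/=.
transitivity (2 * e2 * c * (e1 * k y * a1 y + e3 * t y * a3 y)); last by rewrite ortho ?mulr0.
by ring.
Qed.

(** If the constant vanished, the algebraic relations would force
    [a3 = sg * a1] with [sg] the constant sign of [t]; differentiating gives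
    [t = sg * k], and the curve would be a helix. *)
Lemma first_integral_neq0 K :
  (forall s, I s -> e1 * a1 s ^+ 2 + e3 * a3 s ^+ 2 = K) -> K != 0.
Proof.
move=> KE; apply/eqP => K0; apply: nhelix.
have [sg sg1 sgt] : exists2 sg : R, sg ^+ 2 = 1 & forall s, I s -> 0 < sg * t s.
  have [sg sg1 sgt] : exists2 sg : R, sg ^+ 2 = 1 & forall s, I s -> 0 < sg * (e2 * t s * c).
    apply: (darboux_sign iI oI da3) => s Is.
    by rewrite !mulf_neq0 ?t0// sqr1_neq0.
  have z0 : sg * e2 * c != 0 by rewrite !mulf_neq0// sqr1_neq0.
  exists (Num.sg (sg * e2 * c)) => [|s /sgt]; first by rewrite sqr_sg z0.
  rewrite (_ : _ * _ = (sg * e2 * c) * t s); last by ring.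
  move=> zt; rewrite -(pmulr_rgt0 _ (x := `|sg * e2 * c|)) ?normr_gt0//.
  by rewrite mulrA (mulrC `| _ |) -numEsg.
have a13 s : I s -> a3 s = sg * a1 s.
  move=> Is; have := KE s Is; rewrite K0; have := ortho Is.
  have e1C : e1 = 1 \/ e1 = -1 by exact: sqr1_pm1.
  have e3C : e3 = 1 \/ e3 = -1 by exact: sqr1_pm1.
  (* For [e1 = e3] both components vanish. *)
  have same : a1 s ^+ 2 + a3 s ^+ 2 = 0 -> a3 s = sg * a1 s.
    move=> /eqP; rewrite paddr_eq0 ?sqr_ge0// !sqrf_eq0 => /andP[/eqP-> /eqP->].
    by rewrite mulr0.
  (* For [e1 = - e3] the other root [a3 = - sg * a1] is only possible at zero,
     because [k + sg * t] is positive. *)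
  have diff : k s * a1 s = t s * a3 s -> a1 s ^+ 2 = a3 s ^+ 2 -> a3 s = sg * a1 s.
    move=> kt /eqP; rewrite eq_sym -[a1 s ^+ 2]mul1r -sg1 -exprMn eqf_sqr => /orP[/eqP//|/eqP a3E].
    have : (k s + sg * t s) * a1 s = 0 by rewrite mulrDl kt a3E; ring.
    move/eqP; rewrite mulf_eq0 gt_eqF ?addr_gt0 ?k0 ?sgt//= => /eqP a10.
    by rewrite a3E a10 !mulr0 oppr0.
  case: e1C => ->; case: e3C => -> h1 h2; [apply: same|apply: diff|apply: diff|apply: same]; lra.
exists sg => s Is; apply: (canLR (mulfK _)); first by rewrite gt_eqF ?k0.
have d := is_deriveB (da3 Is) (is_deriveZ sg (da1 Is)).
have [_ d0] : is_derive s 1 (a3 - sg *: a1) 0.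
  apply: (@near_eq_is_derive _ _ _ (cst 0)).
  near=> y; have Iy : I y by near: y; exact: open_nbhs_nbhs.
  by rewrite /= !fctE a13// /GRing.scale/= subrr.
move: d => [_]; rewrite d0 /GRing.scale/= => /eqP; rewrite eq_sym.
rewrite (_ : _ - _ = e2 * c * (t s - sg * k s)); last by ring.
rewrite !mulf_eq0 (negPf c0) (negPf (sqr1_neq0 e2E))/= subr_eq0.
by move=> /eqP.
Unshelve. all: by end_near. Qed.

(** With [K] the first integral, [ortho] gives [D = k ^+ 2 * K / a3 ^+ 2] and
    [t / k = - e1 * e3 * a1 / a3], so that all quantities are explicit in
    [k], [a1], [a3]; the sign of [a3], constant on the interval, enters through
    the square root of [D]. *)
Lemma slant_system :
  let D := fun s => e1 * t s ^+ 2 + e3 * k s ^+ 2 in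
  [/\ (forall s, I s -> D s != 0),
  (exists C : R, forall s, I s -> k s ^+ 2 / (`| D s | `^ (3 / 2))
     * derive1 (fun t0 : R^o => t t0 / k t0 : R^o) s = C) &
  (exists2 n : R, n != 0 & forall s, I s ->
     e1 * a1 s = n * t s / Num.sqrt `|D s| /\
     e3 * a3 s = - (n * k s / Num.sqrt `|D s|))].
Proof.
move=> D; have [K KE] := first_integral; have K0 := first_integral_neq0 KE.
have e10 := sqr1_neq0 e1E; have e30 := sqr1_neq0 e3S.
have a30 s : I s -> a3 s != 0.
  move=> Is; apply/eqP => a3s; have a1s : a1 s = 0.
    have /eqP := ortho Is; rewrite a3s mulr0 addr0.
    by rewrite !mulf_eq0 (negPf e10) gt_eqF ?k0//= => /eqP.
  by move: K0; rewrite -(KE s Is) a3s a1s expr0n !mulr0 addr0 eqxx.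
have tE s : I s -> t s = - (e1 * e3 * k s * a1 s / a3 s).
  move=> Is; apply: (mulIf (a30 s Is)); rewrite mulNr divfK ?a30//.
  rewrite -[t s]mul1r -e3S.
  transitivity (e3 * (e1 * k s * a1 s + e3 * t s * a3 s) - e1 * e3 * k s * a1 s); first ring.
  by rewrite ortho//; ring.
have [sg sg1 sgP] := sign_of_nonzero iI nI da3 a30.
have DE s : I s -> D s = k s ^+ 2 * K / a3 s ^+ 2.
  move=> Is; have := a30 s Is => a3s.
  have -> : D s = (e1 ^+ 3 * e3 ^+ 2 * a1 s ^+ 2 + e3 * a3 s ^+ 2) * k s ^+ 2 / a3 s ^+ 2.
    by rewrite /D tE//; field.
  rewrite exprS e1E e3S !mulr1 KE//; field.
  exact: a3s.
pose q := Num.sqrt `|K|.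
have q0 : 0 < q by rewrite sqrtr_gt0 normr_gt0.
have sqD s : I s -> Num.sqrt `|D s| = sg * k s * q / a3 s.
  move=> Is; have a3s := a30 s Is.
  rewrite DE// !normrM normfV !normrX sqrtrM ?mulr_ge0 ?exprn_ge0//.
  rewrite sqrtrM ?exprn_ge0// sqrtrV ?exprn_ge0// !sqrtr_sqr !normr_id.
  rewrite (gtr0_norm (k0 Is)).
  have -> : `|a3 s| = sg * a3 s.
    rewrite -[RHS]gtr0_norm ?sgP// normrM.
    by have [->|->] := sqr1_pm1 sg1; rewrite ?normrN normr1 mul1r.
  have sg0 := sqr1_neq0 sg1.
  have sgV : sg^-1 = sg by apply: (mulfI sg0); rewrite divff// -expr2.
  by rewrite invfM sgV -/q; ring.
split.
- move=> s Is; have a3s := a30 s Is; have ks : k s != 0 by rewrite gt_eqF ?k0.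
  by rewrite DE// mulf_neq0 ?invr_neq0 ?mulf_neq0 ?expf_neq0.
- exists (sg * e3 * c * K / q ^+ 3) => s Is.
  have a3s := a30 s Is; have ks : k s != 0 by rewrite gt_eqF ?k0.
  have -> : `|D s| `^ (3 / 2) = Num.sqrt `|D s| ^+ 3.
    by rewrite mulrC powRrM powR12_sqrt// -powR_mulrn ?sqrtr_ge0.
  rewrite sqD//.
  have -> : derive1 (fun t0 : R^o => t t0 / k t0 : R^o) s = e3 * c * k s * K / a3 s ^+ 3.
    (* The derivatives of [a1] and [a3] are given, those of [t] and [k] are
       not, so the quotient is rewritten before differentiating. *)
    transitivity (derive1 ((- (e1 * e3)) *: (a1 * (fun y => (a3 y)^-1))) s).
      rewrite !derive1E; apply: near_eq_derive; near=> y.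
      have Iy : I y by near: y; exact: open_nbhs_nbhs.
      have ky : k y != 0 by rewrite gt_eqF ?k0.
      have a3y := a30 y Iy.
      by rewrite tE// !fctE /GRing.scale/=; field; rewrite ky a3y.
    have dV := is_deriveV a3s (da3 Is).
    have [_ dE] := is_deriveZ (- (e1 * e3)) (is_deriveM (da1 Is) dV).
    rewrite derive1E dE /GRing.scale/=.
    transitivity (e2 * c * k s * (- (e1 * e3)) * (a3 s ^+ 2 + (e1 * e3) * a1 s ^+ 2) / a3 s ^+ 3).
      by rewrite tE//; field.
    rewrite -(KE s Is) e3E.
    transitivity (c * k s * ((e1 ^+ 2 * e2 ^+ 2) * a3 s ^+ 2 -
      (e1 ^+ 4 * e2 ^+ 3) * a1 s ^+ 2) / a3 s ^+ 3).
      by field.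
    rewrite (exprM e1 2 2) [e2 ^+ 3]exprS e1E e2E expr1n !mulr1 !mul1r.
    transitivity (c * k s * ((e1 ^+ 2 * e2 ^+ 2) * a3 s ^+ 2 -
      (e1 ^+ 2 * e2) * a1 s ^+ 2) / a3 s ^+ 3).
      by rewrite e1E e2E !mul1r.
    by field.
  have qn : q != 0 by rewrite gt_eqF.
  have sg0 := sqr1_neq0 sg1.
  have -> : sg * e3 * c * K / q ^+ 3 = sg ^+ 4 * (e3 * c * K) / (sg ^+ 3 * q ^+ 3).
    by field; rewrite sg0 qn.
  rewrite (_ : sg ^+ 4 = 1); last by rewrite (exprM sg 2 2) sg1 expr1n.
  by field; rewrite a3s ks qn sg0.
(* The sign is dictated by [e3 * a3 = - n * k / sqrt `|D|], where
   [sqrt `|D| = sg * k * q / a3]. *)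
exists (- (e3 * sg * q)) => [|s Is].
  by rewrite oppr_eq0 !mulf_neq0 ?(sqr1_neq0 sg1)// gt_eqF.
have a3s := a30 s Is; have ks : k s != 0 by rewrite gt_eqF ?k0.
have qn : q != 0 by rewrite gt_eqF.
have sg0 := sqr1_neq0 sg1.
rewrite sqD//; split; last by field; rewrite a3s ks qn sg0.
rewrite tE//; transitivity (e3 ^+ 2 * (e1 * a1 s)); first by rewrite e3S mul1r.
by field; rewrite a3s ks qn sg0.
Unshelve. all: by end_near. Qed.

End SlantSystem.

(** * Frame components of the axis along the curve *)

Section Frame.
Variables (R : realType) (M : manifold3 R) (g : tensor2 M).
Hypothesis lg : lorentz_metric g.

(** The Gram matrix of the family being diagonal and invertible, the family is
    free, hence a basis, and a vector is determined by its products with it. *)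
Lemma orthonormal_expansion (p : M) (V : 'I_3 -> tangent p) (eps : 'I_3 -> R)
    (w : tangent p) :
  (forall i, eps i != 0) ->
  (forall i j, g (V i) (V j) = if i == j then eps i else 0) ->
  w = \sum_(i < 3) (g w (V i) / eps i) *: V i.
Proof.
move=> eps0 gV.
have gsum (b : 'I_3 -> R) j : g (\sum_(i < 3) b i *: V i) (V j) = b j * eps j.
  rewrite (metric_suml lg) (bigD1 j)//= big1 ?addr0 => [|i ij].
    by rewrite (metricZl lg) gV eqxx.
  by rewrite (metricZl lg) gV (negPf ij) mulr0.
pose P : 'M[R]_3 := \matrix_(i, j) (V i : 'rV[R]_3) 0 j.
have rP i : row i P = V i by apply/rowP => j; rewrite !mxE.
have sumP (u : 'rV[R]_3) : u *m P = \sum_(i < 3) u 0 i *: V i.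
  by rewrite mulmx_sum_row; under eq_bigr do rewrite rP.
have uP : P \in unitmx.
  rewrite -row_free_unit; apply: inj_row_free => u uP0; apply/rowP => j.
  have := gsum (fun i => u 0 i) j.
  rewrite (_ : \sum_(i < 3) _ = 0); last first.
    by apply: etrans (esym _) uP0; rewrite sumP.
  by rewrite (metric0l lg) => /esym/eqP; rewrite mulf_eq0 (negPf (eps0 j)) orbF mxE => /eqP.
apply: (metric_inj lg) => v.
have -> : v = \sum_(i < 3) ((v : 'rV[R]_3) *m invmx P) 0 i *: V i.
  by rewrite -sumP mulmxKV.
rewrite !(metric_sumr lg); apply: eq_bigr => j _; rewrite !(metricZr lg); congr (_ * _).
by rewrite gsum divfK.
Qed.

Lemma orthonormal_frame_expansion (p : M) (e1 e2 e3 : R) (V1 V2 V3 w : tangent p) :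
  e1 ^+ 2 = 1 -> e2 ^+ 2 = 1 -> e3 ^+ 2 = 1 ->
  [/\ g V1 V1 = e1, g V2 V2 = e2 & g V3 V3 = e3] ->
  [/\ g V1 V2 = 0, g V1 V3 = 0 & g V2 V3 = 0] ->
  w = (e1 * g w V1) *: V1 + (e2 * g w V2) *: V2 + (e3 * g w V3) *: V3.
Proof.
move=> e1E e2E e3E [g11 g22 g33] [g12 g13 g23].
have inv (e : R) : e ^+ 2 = 1 -> e^-1 = e.
  by move=> eE; apply: (mulfI (sqr1_neq0 eE)); rewrite divff ?sqr1_neq0// -expr2.
have := @orthonormal_expansion p (fun i => [:: V1; V2; V3]`_i) (fun i => [:: e1; e2; e3]`_i) w _ _.
rewrite !big_ord_recr big_ord0 /= add0r !inv// ![g w _ * _]mulrC; apply.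
  by case=> [[|[|[|]]]]//= _; exact: sqr1_neq0.
by move=> [[|[|[|i]]] ilt] [[|[|[|j]]] jlt] //=; rewrite (metricC lg).
Qed.

(** A function with zero Hessian has a parallel gradient, so only the second
    field contributes to the derivative of the product. *)
Lemma is_derive_gradient_along (f : M -> R) (I : set R) (alpha : R -> M)
    (V : field_along alpha) (s : R) :
  smooth_fun f -> (forall (p : M) (X Y : tangent p), hessian g f X Y = 0) ->
  smooth_curve I alpha -> smooth_along I V -> I s ->
  is_derive s 1 (fun t : R => g (gradient g f (alpha t)) (V t))
    (g (gradient g f (alpha s)) (nabla_along g V s)).
Proof.
move=> sf H0 sa sV Is.
have := is_derive_metric_along lg (X := gradient g f) sa sV Is.
have -> : g (nabla g (velocity alpha s) (gradient g f)) (V s) = 0 by exact: H0.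
rewrite add0r; apply.
apply: (differentiable_gradient lg sf); first exact: chart_at_atlas.
exact/cimg_map/chart_at_dom.
Qed.

End Frame.

Unset Implicit Arguments.

Theorem theorem2p1 (R : realType) (M : manifold3 R) (g : tensor2 M)
    (T : vector_field M) (I : set R) (alpha : R -> M)
    (eps1 eps2 eps3 : R) (V1 V2 V3 : field_along alpha) (kappa tau : R -> R)
    (f : M -> R) :
  lorentz_metric g ->
  time_orientation g T ->
  frenet_curve I alpha g eps1 ->
  frenet_frame I g eps1 eps2 eps3 V1 V2 V3 kappa tau ->
  (forall s, I s -> kappa s != 0) ->
  (forall s, I s -> tau s != 0) ->
  ~ helix I kappa tau ->
  smooth_fun f ->
  eikonal_along I alpha g f ->
  (forall (p : M) (X Y : tangent p), hessian g f X Y = 0) ->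
  eikonal_slant_helix I g f V2 ->
  let D := fun s => eps1 * tau s ^+ 2 + eps3 * kappa s ^+ 2 in
  [/\ (forall s, I s -> D s != 0),
      (exists C : R, forall s, I s ->
         kappa s ^+ 2 / (`| D s | `^ (3 / 2))
           * derive1 (fun t : R^o => tau t / kappa t : R^o) s = C) &
      (exists c n : R, [/\ c != 0, n != 0 & forall s, I s ->
         gradient g f (alpha s) =
           (n * tau s / Num.sqrt `| D s |) *: V1 s + c *: V2 s
           - (n * kappa s / Num.sqrt `| D s |) *: V3 s])].
Proof.
move=> lg _ fc ff k0 t0 nh sf _ H0 [c c0 a2E] D.
have [sV1 sV2 sV3] := frame_smooth ff.
have [e1C e2C e3C e3E] := frame_signs ff.
have pm (e : R) : e = 1 \/ e = -1 -> e ^+ 2 = 1.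
  by case=> ->; rewrite ?sqrrN expr1n.
have e1S := pm _ e1C; have e2S := pm _ e2C; have e3S := pm _ e3C.
have oI := curve_open fc; have sa := curve_smooth fc.
have kgt0 s : I s -> 0 < kappa s.
  by move=> Is; rewrite lt_neqAle eq_sym k0 ?(frame_curvature_ge0 ff).
pose a1 s := g _ (gradient g f (alpha s)) (V1 s).
pose a3 s := g _ (gradient g f (alpha s)) (V3 s).
have da1 s : I s -> is_derive s 1 a1 (eps2 * kappa s * c).
  move=> Is; have := is_derive_gradient_along lg sf H0 sa sV1 Is.
  by have [-> _ _] := frame_equations ff Is; rewrite (metricZr lg) a2E.
have da3 s : I s -> is_derive s 1 a3 (eps2 * tau s * c).
  move=> Is; have := is_derive_gradient_along lg sf H0 sa sV3 Is.
  by have [_ _ ->] := frame_equations ff Is; rewrite (metricZr lg) a2E.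
have ortho s : I s -> eps1 * kappa s * a1 s + eps3 * tau s * a3 s = 0.
  move=> Is; have [_] := is_derive_gradient_along lg sf H0 sa sV2 Is.
  have near_c : \forall t \near s, g _ (gradient g f (alpha t)) (V2 t) = cst c t.
    by near=> t; apply: a2E; near: t; exact: open_nbhs_nbhs.
  rewrite (near_eq_derive _ near_c) derive_cst; have [_ -> _] := frame_equations ff Is.
  rewrite -opprD -scaleN1r (metricZr lg) (metricC lg) (metricDl lg).
  rewrite !(metricZl lg) ![g _ _ (gradient _ _ _)](metricC lg) -/(a1 s) -/(a3 s).
  by move=> /eqP; rewrite mulN1r eq_sym oppr_eq0 => /eqP.
have [D0 HC [n n0 Hn]] :=
  slant_system (curve_interval fc) oI (curve_nonempty fc) e1S e2S e3E c0 kgt0 t0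
    da1 da3 ortho nh.
split=> //; exists (eps2 * c), n; split=> // [|s Is].
  by rewrite mulf_neq0// sqr1_neq0.
have [h1 h3] := Hn s Is.
rewrite [LHS](orthonormal_frame_expansion lg _ e1S e2S e3S
  (frame_norms ff Is) (frame_orthogonal ff Is)).
by rewrite a2E// h1 h3 scaleNr.
Unshelve. all: by end_near. Qed.
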